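(* Suppose that the kernel $\gamma(\mathbf{x},\mathbf{y})=\tilde\gamma(|\mathbf{y}-\mathbf{x}|)$ satisfies the kernel assumptions (K1) and (K2) stated in the context, and that $b\in C(\Omega)$. Then the solution $u$ of the homogeneous nonlocal problem $$-\mathcal{L}u(\mathbf{x})=b(\mathbf{x})\ \text{ on }\Omega,\qquad u(\mathbf{x})=0\ \text{ on }\Omega_I,$$ is continuous in $\Omega$, i.e. $u\in C(\Omega)$.
   Context: $\Omega\subset\mathbb{R}^d$ is a bounded, open, convex domain with Lipschitz boundary, $\delta>0$ is a constant (the horizon), and $\Omega_I=\{\mathbf{y}\in\mathbb{R}^d\setminus\Omega:\ \mathrm{dist}(\mathbf{y},\partial\Omega)<\delta\}$. For $\mathbf{x}\in\Omega\cup\Omega_I$ and $r>0$, $B_r(\mathbf{x})=\{\mathbf{y}\in\Omega\cup\Omega_I:\ |\mathbf{y}-\mathbf{x}|\le r\}$. The nonlocal operator is $$\mathcal{L}u(\mathbf{x})=\int_{\mathbb{R}^d}\big(u(\mathbf{y})-u(\mathbf{x})\big)\gamma(\mathbf{x},\mathbf{y})\,d\mathbf{y},\qquad \mathbf{x}\in\Omega.$$ Kernel assumptions on the nonnegative symmetric kernel $\gamma$: (K1) there is a constant $\gamma_0>0$ such that for all $\mathbf{x}\in\Omega\cup\Omega_I$: $\gamma(\mathbf{x},\mathbf{y})\ge\gamma_0$ for all $\mathbf{y}\in B_{\delta/2}(\mathbf{x})$, and $\gamma(\mathbf{x},\mathbf{y})=0$ for all $\mathbf{y}\in(\Omega\cup\Omega_I)\setminus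 B_\delta(\mathbf{x})$; (K2) $\gamma(\mathbf{x},\mathbf{y})=\tilde\gamma(|\mathbf{y}-\mathbf{x}|)\ge0$ and $\int_{\mathbb{R}^d}\tilde\gamma(|\mathbf{z}|)\,d\mathbf{z}=1$. Interactions are limited to distance $\delta$: $\tilde\gamma(r)=0$ for $r>\delta$. Standing assumptions: $b\in L^2(\Omega)$, and the function $\mathbf{s}\mapsto\tilde\gamma(|\mathbf{s}|)$ belongs to $L^2(\mathbb{R}^d)$. The solution is the function $u\in L^2(\Omega\cup\Omega_I)$ with $u=0$ a.e. on $\Omega_I$ and $-\mathcal{L}u=b$ a.e. in $\Omega$; $u\in C(\Omega)$ means that $u|_\Omega$ has a continuous representative on the open set $\Omega$. *)

(* Defs.v *)
From HB Require Import structures.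
From mathcomp Require Import all_boot all_order all_algebra.
From mathcomp Require Import all_classical all_reals all_analysis.

Set Implicit Arguments.
Unset Strict Implicit.
Unset Printing Implicit Defensive.

Import Order.TTheory GRing.Theory Num.Theory.
Import numFieldNormedType.Exports.

Local Open Scope classical_set_scope.
Local Open Scope ring_scope.

(* The measurable structure of R^n is the product (i.e. Borel) sigma-algebra,
   generated by the coordinates as the library does for n.-tuple; row vectors
   are used because they also carry the topology and the module structure. *)
Definition measure_rV_display : measure_display -> measure_display.
Proof. exact. Qed.

Section measurable_rV.
Context {R : realType} (n : nat).

Let coords : 'I_n -> 'rV[R]_n -> R := fun i x => x ord0 i.

Let rV_set0 : g_sigma_preimage coords set0.
Proof. exact: sigma_algebra0. Qed.

Let rV_setC A : g_sigma_preimage coords A -> g_sigma_preimage coords (~` A).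
Proof. exact: sigma_algebraC. Qed.

Let rV_bigcup (F : _^nat) : (forall i, g_sigma_preimage coords (F i)) ->
  g_sigma_preimage coords (\bigcup_i (F i)).
Proof. exact: sigma_algebra_bigcup. Qed.

HB.instance Definition _ := @isMeasurable.Build
  (measure_rV_display default_measure_display)
  'rV[R]_n (g_sigma_preimage coords) rV_set0 rV_setC rV_bigcup.

End measurable_rV.

Section lebesgue_rV.
Context {R : realType}.
Local Open Scope ereal_scope.

Definition cons_rV n (p : measurableTypeR R * 'rV[R]_n) : 'rV[R]_n.+1 :=
  row_mx (const_mx p.1 : 'rV_1) p.2.

(* Lebesgue measure on R^n: the point mass on R^0, then R^(m+1) = R x R^m. *)
Fixpoint lebesgue_rV (n : nat) : set 'rV[R]_n -> \bar R :=
  match n with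
  | 0%N => \d_(0%R : 'rV[R]_0)
  | m.+1 => pushforward (@lebesgue_measure R \x @lebesgue_rV m) (@cons_rV m)
  end.

Lemma measurable_coord n (i : 'I_n) :
  measurable_fun [set: 'rV[R]_n] (fun x : 'rV[R]_n => x ord0 i).
Proof.
move=> _ Y mY; rewrite setTI; apply: sub_sigma_algebra => /=.
rewrite -bigcup_seq/=; exists i => /=; first by rewrite mem_index_enum.
by exists Y => //; rewrite setTI.
Qed.

Lemma measurable_fun_rV d (T : measurableType d) n (f : T -> 'rV[R]_n) :
  (forall i, measurable_fun [set: T] (fun x => f x ord0 i)) ->
  measurable_fun [set: T] f.
Proof.
move=> mf _ Y mY; rewrite setTI.
suff: (@measurable _ 'rV[R]_n) `<=` [set Z | measurable (f @^-1` Z)] by exact.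
apply: smallest_sub.
  split => /=; first by rewrite preimage_set0.
    by move=> A mA; rewrite setTD preimage_setC; exact: measurableC.
  by move=> F mF; rewrite preimage_bigcup; exact: bigcup_measurable.
elim/big_ind: _ => //.
- by move=> A B sA sB Z [/sA|/sB].
- move=> i _ _ [Z mZ <-]/=; rewrite setTI -comp_preimage -[X in measurable X]setTI.
  exact: mf.
Qed.

Lemma measurable_cons_rV n : measurable_fun setT (@cons_rV n).
Proof.
apply: measurable_fun_rV; rewrite -[n.+1]/(1 + n)%N => i.
case: (split_ordP i) => j ->.
  rewrite (_ : (fun _ => _) = fst) //; apply/funext => x.
  by rewrite row_mxEl mxE.
rewrite (_ : (fun _ => _) = (fun y : 'rV[R]_n => y ord0 j) \o snd).
  exact: measurableT_comp (measurable_coord j) measurable_snd.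
by apply/funext => x /=; rewrite row_mxEr.
Qed.

Definition uncons_rV n (x : 'rV[R]_n.+1) : measurableTypeR R * 'rV[R]_n :=
  (x ord0 ord0, rsubmx (x : 'rV_(1 + n))).

Lemma measurable_uncons_rV n : measurable_fun setT (@uncons_rV n).
Proof.
apply: measurable_fun_pair; first exact: (measurable_coord ord0).
apply: measurable_fun_rV => i.
rewrite (_ : (fun _ => _) = (fun x : 'rV[R]_n.+1 => x ord0 (rshift 1 i))).
  exact: measurable_coord.
by apply/funext => x; rewrite mxE.
Qed.

Lemma cons_rVK n : cancel (@cons_rV n) (@uncons_rV n).
Proof.
move=> -[x y]; rewrite /uncons_rV /cons_rV row_mxKr /=; congr pair.
transitivity (row_mx (const_mx x : 'rV_1) y ord0 (lshift n ord0)).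
  by congr (row_mx _ _ _ _); exact/val_inj.
by rewrite row_mxEl mxE.
Qed.

Section lebesgue_rV_succ.
Context (n : nat) (mu : {sigma_finite_measure set 'rV[R]_n -> \bar R}).

Let m : {measure set (measurableTypeR R * 'rV[R]_n)%type -> \bar R} :=
  @lebesgue_measure R \x mu.

Let nu := pushforward m (@cons_rV n).

Let nu0 : nu set0 = 0.
Proof. by rewrite /nu /pushforward preimage_set0 measure0. Qed.

Let nu_ge0 A : 0 <= nu A.
Proof. exact: (measure_ge0 m). Qed.

Let nu_sigma_additive : semi_sigma_additive nu.
Proof.
have mpre A : measurable A -> measurable (@cons_rV n @^-1` A).
  by move=> mA; rewrite -[X in measurable X]setTI; exact: measurable_cons_rV.
move=> F mF tF mUF; rewrite /nu /pushforward preimage_bigcup.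
apply: measure_semi_sigma_additive.
- by move=> i; exact: mpre.
- apply/trivIsetP => /= i j _ _ ij; rewrite -preimage_setI.
  by move/trivIsetP : tF => /(_ _ _ _ _ ij) ->//; rewrite preimage_set0.
- by rewrite -preimage_bigcup; exact: mpre.
Qed.

HB.instance Definition _ := isMeasure.Build _ _ _ nu
  nu0 nu_ge0 nu_sigma_additive.

Let nu_sigma_finite : sigma_finite setT nu.
Proof.
have /sigma_finiteP[F [FT ndF Foo]] := sigma_finiteT (@lebesgue_measure R).
have /sigma_finiteP[G [GT ndG Goo]] := sigma_finiteT mu.
exists (fun k => @uncons_rV n @^-1` (F k `*` G k)).
  rewrite -preimage_bigcup (_ : \bigcup_i _ = setT) ?preimage_setT//.
  apply/seteqP; split=> // -[x y] _.
  have [i _ Fix] : (\bigcup_i F i) x by rewrite -FT.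
  have [j _ Gjy] : (\bigcup_i G i) y by rewrite -GT.
  exists (maxn i j) => //; split=> /=.
    by move: x Fix; exact/subsetPset/ndF/leq_maxl.
  by move: y Gjy; exact/subsetPset/ndG/leq_maxr.
move=> k; have [mF Fk] := Foo k; have [mG Gk] := Goo k; split.
  rewrite -[X in measurable X]setTI; apply: measurable_uncons_rV => //.
  exact: measurableX.
rewrite /nu /pushforward -comp_preimage (_ : _ \o _ = id); last first.
  by apply/funext => p; exact: cons_rVK.
rewrite preimage_id [ltLHS]product_measure1E// lte_mul_pinfty//.
by rewrite ge0_fin_numE.
Qed.

HB.instance Definition _ := Measure_isSigmaFinite.Build _ _ _ nu
  nu_sigma_finite.

Definition lebesgue_rV_succ :
  {sigma_finite_measure set 'rV[R]_n.+1 -> \bar R} := nu.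

End lebesgue_rV_succ.

Let lebesgue_rV_ex n :
  exists mu : {sigma_finite_measure set 'rV[R]_n -> \bar R},
    mu = @lebesgue_rV n :> (set _ -> \bar R).
Proof.
elim: n => [|n [mu mu_n]]; first by exists \d_(0%R : 'rV[R]_0).
by exists (lebesgue_rV_succ mu); rewrite /= -mu_n.
Qed.

Let lebesgue_rV0 n : @lebesgue_rV n set0 = 0.
Proof. by have [mu <-] := lebesgue_rV_ex n; exact: measure0. Qed.

Let lebesgue_rV_ge0 n A : 0 <= @lebesgue_rV n A.
Proof. by have [mu <-] := lebesgue_rV_ex n; exact: measure_ge0. Qed.

Let lebesgue_rV_sigma_additive n : semi_sigma_additive (@lebesgue_rV n).
Proof.
by have [mu <-] := lebesgue_rV_ex n; exact: measure_semi_sigma_additive.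
Qed.

HB.instance Definition _ n := isMeasure.Build _ _ _ (@lebesgue_rV n)
  (@lebesgue_rV0 n) (@lebesgue_rV_ge0 n) (@lebesgue_rV_sigma_additive n).

Let lebesgue_rV_sigma_finite n : sigma_finite setT (@lebesgue_rV n).
Proof. by have [mu <-] := lebesgue_rV_ex n; exact: sigma_finiteT. Qed.

HB.instance Definition _ n := Measure_isSigmaFinite.Build _ _ _ (@lebesgue_rV n)
  (@lebesgue_rV_sigma_finite n).

End lebesgue_rV.
Arguments lebesgue_rV {R n}.

Section nonlocal.
Context {R : realType} (d : nat).
Implicit Types (A Omega : set 'rV[R]_d) (f u b : 'rV[R]_d -> R).

(* The library norm of 'rV[R]_d is the sup norm; it is used below only through
   notions (topology, boundedness, Lipschitz continuity) for which the choice
   of the norm is immaterial. *)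
Definition enorm (x : 'rV[R]_d) : R := Num.sqrt (\sum_i x ord0 i ^+ 2).

Definition boundary A : set 'rV[R]_d := closure A `\` interior A.

Definition set_dist (x : 'rV[R]_d) A : R := inf [set enorm (x - a) | a in A].

Definition is_domain Omega : Prop :=
  [/\ open Omega, connected Omega & Omega !=set0].

Definition interaction_domain (delta : R) Omega : set 'rV[R]_d :=
  [set y | ~ Omega y /\ set_dist y (boundary Omega) < delta].

Definition nonlocal_ball (delta : R) Omega (r : R) (x : 'rV[R]_d) :
    set 'rV[R]_d :=
  [set y | (Omega `|` interaction_domain delta Omega) y /\ enorm (y - x) <= r].

Definition L2_on A f : Prop := (f \_ A) \in Lfun (@lebesgue_rV R d) 2%:E.

Definition continuous_rep A f : Prop :=
  exists2 g : 'rV[R]_d -> R, {within A, continuous g} &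
    {ae @lebesgue_rV R d, forall x, A x -> f x = g x}.

Definition nonlocal_op (gamma : 'rV[R]_d -> 'rV[R]_d -> R) u (x : 'rV[R]_d) : R
  := \int[@lebesgue_rV R d]_y ((u y - u x) * gamma x y).

Definition kernel_K1 (delta : R) Omega (gamma : 'rV[R]_d -> 'rV[R]_d -> R) :
    Prop :=
  let D := Omega `|` interaction_domain delta Omega in
  exists2 gamma0 : R, 0 < gamma0 & forall x, D x ->
    (forall y, nonlocal_ball delta Omega (delta / 2) x y ->
      gamma0 <= gamma x y) /\
    (forall y, (D `\` nonlocal_ball delta Omega delta x) y -> gamma x y = 0).

Definition kernel_K2 (gamma : 'rV[R]_d -> 'rV[R]_d -> R) (gammat : R -> R) :
    Prop :=
  (forall x y, gamma x y = gammat (enorm (y - x)) /\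
    0 <= gammat (enorm (y - x))) /\
  (\int[@lebesgue_rV R d]_z (gammat (enorm z))%:E = 1)%E.

(* u is a function on all of R^d, but its values outside Omega and the
   interaction domain are irrelevant when gamma has range delta.  In that
   situation the integrand of nonlocal_op is integrable as well, so its real
   integral takes no default value. *)
Definition nonlocal_solution (delta : R) Omega gamma b u : Prop :=
  let OmegaI := interaction_domain delta Omega in
  [/\ L2_on (Omega `|` OmegaI) u,
      {ae @lebesgue_rV R d, forall x, OmegaI x -> u x = 0} &
      {ae @lebesgue_rV R d, forall x, Omega x -> - nonlocal_op gamma u x = b x}].

End nonlocal.

(* Near each boundary point p, in an orthonormal frame centred at p (given by
   the orthogonal matrix Q), Omega is the strict epigraph of a Lipschitz
   function of the last n coordinates. *)
Definition lipschitz_boundary {R : realType} (n : nat)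
    (Omega : set 'rV[R]_n.+1) : Prop :=
  forall p, boundary Omega p ->
  exists (r : R) (Q : 'M[R]_n.+1) (phi : 'rV[R]_n -> R),
    [/\ 0 < r, Q *m Q^T = 1%:M, lipschitz phi &
      forall x, enorm (x - p) < r ->
        let y := (x - p) *m Q in
        Omega x <-> phi (col' ord0 y) < y ord0 ord0].

(* Main.v *)
Require Import Defs.
From HB Require Import structures.
From mathcomp Require Import all_boot all_order all_algebra.
From mathcomp Require Import all_classical all_reals all_analysis.
From mathcomp Require Import measurable_realfun ring lra.
Import Order.TTheory GRing.Theory Num.Theory.
Import numFieldNormedType.Exports.
Local Open Scope classical_set_scope.
Local Open Scope ring_scope.
Set Implicit Arguments.
Unset Strict Implicit.
Unset Printing Implicit Defensive.

(** Write D for the union of Omega and its interaction domain, w for u extended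
by zero outside D, and k for the radial function z |-> gammat |z|.  When x lies
in Omega, every y with |y - x| <= delta lies in D: otherwise the segment from x
to y leaves Omega through a boundary point p different from x, and then
|y - p| < |y - x| <= delta ([enorm_le_interaction]).  Hence gamma x y * u y is
w y * k (y - x) for every y, and since k has integral 1 the equation
- L u = b reads

  u x = b x + (integral over y of w y * k (y - x))   for almost every x in Omega.

Both w and k are square integrable, so the theorem reduces to the continuity of
the correlation of two square integrable functions ([continuous_correlation]).
By the inequality |w d| <= t w^2 + d^2 / t, this follows from the continuity of
translations in L^2: the squared distance from k to its translate by h tends to
0 with h.

The functions with that property form a linear space which is closed under
dominated pointwise limits ([L2_translation_continuous_lin],
[L2_translation_continuous_cvg]) and contains the Lipschitz functions with
bounded support.  The pi-lambda theorem then puts the indicators of all bounded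
measurable sets in it ([L2_translation_continuous_cutoff_indic]), simple
functions follow by linearity and all square integrable functions by
approximation.  Two properties of Lebesgue measure carry this: it is invariant
under translations ([lebesgue_rV_shift]) and finite on balls
([lebesgue_rV_ball]). *)

(** * Translation invariance of Lebesgue measure *)

Section translation.
Context {R : realType}.

Lemma lebesgue_measure_shift (a : R) (A : set (measurableTypeR R)) :
  measurable A ->
  pushforward lebesgue_measure
    ((fun x => x - a) : measurableTypeR R -> measurableTypeR R) A =
  lebesgue_measure A.
Proof.
move=> mA.
have ms : measurable_fun setT
    ((fun x => x - a) : measurableTypeR R -> measurableTypeR R).
  exact: measurable_funB.
pose nu : {measure set (measurableTypeR R) -> \bar R} :=
  measure_function_pushforward__canonical__measure_function_Measure
    lebesgue_measure ms.
apply/esym/(lebesgue_measure_unique (mu := nu)) => // _ [[b c]] _ <-.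
rewrite /nu/= /pushforward (_ : _ @^-1` _ = `]b + a, c + a]%classic).
  rewrite !lebesgue_measure_itv/= !lte_fin ltrD2r -!EFinD.
  by rewrite -[b + a]addrC opprD addrA addrK.
by apply/seteqP; split => x/=; rewrite !in_itv/= ltrBrDr lerBlDr.
Qed.

Lemma measurable_rV_shift n (a : 'rV[R]_n) :
  measurable_fun setT (fun x : 'rV[R]_n => x - a).
Proof.
apply: measurable_fun_rV => i.
rewrite (_ : (fun _ => _) = (fun x : 'rV[R]_n => x ord0 i - a ord0 i)).
  by apply: measurable_funB => //; exact: measurable_coord.
by apply/funext => x; rewrite !mxE.
Qed.

Lemma cons_rVB n (x y : R) (v w : 'rV[R]_n) :
  cons_rV (x, v) - cons_rV (y, w) = cons_rV (x - y, v - w).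
Proof.
rewrite /cons_rV /= (opp_row_mx (n1 := 1)) (add_row_mx (n1 := 1)).
by apply: (congr2 (@row_mx R 1 1 n)) => //; apply/matrixP => i j; rewrite !mxE.
Qed.

Lemma uncons_rVK n : cancel (@uncons_rV R n) (@cons_rV R n).
Proof.
move=> x; rewrite /uncons_rV /cons_rV /= -[RHS](hsubmxK (x : 'rV_(1 + n))).
apply: (congr2 (@row_mx R 1 1 n)) => //; apply/matrixP => i j; rewrite !mxE !ord1.
by congr (x _ _); exact/val_inj.
Qed.

(** By induction on the dimension: the sections of a translated set are
translates of the sections of the set, so the induction hypothesis handles the
last coordinates and a change of variable on the line the first one. *)
Lemma lebesgue_rV_shift n (a : 'rV[R]_n) (A : set 'rV[R]_n) : measurable A ->
  pushforward lebesgue_rV (fun x => x - a) A = lebesgue_rV A.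
Proof.
elim: n a A => [|n IH] a A mA.
  suff <- : id = (fun x : 'rV[R]_0 => x - a) by [].
  by apply/funext => x; apply/rowP => -[].
rewrite /= /pushforward -[a]uncons_rVK; case: (uncons_rV a) => {}a b.
set E := @cons_rV R n @^-1` A.
have mE : measurable E.
  by rewrite -[X in measurable X]setTI; exact: measurable_cons_rV.
pose g (x : measurableTypeR R) := lebesgue_rV (xsection E x).
transitivity (\int[@lebesgue_measure R]_x g (x - a)%R)%E.
  apply: eq_integral => x _ /=; rewrite /g -(IH b (xsection E (x - a)));
    last exact: measurable_xsection.
  congr lebesgue_rV; apply/seteqP; split => y;
    by rewrite /xsection /= !inE /E /= cons_rVB.
have ms : measurable_fun setT
    ((fun x => x - a) : measurableTypeR R -> measurableTypeR R).
  exact: measurable_funB.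
pose nu : {measure set (measurableTypeR R) -> \bar R} :=
  measure_function_pushforward__canonical__measure_function_Measure
    lebesgue_measure ms.
have mg : measurable_fun setT g by exact: measurable_fun_xsection.
have g0 : {in setT, forall y, 0 <= g y}%E by [].
have := ge0_integral_pushforward ms lebesgue_measure measurableT mg g0.
rewrite preimage_setT => <-.
exact: (eq_measure_integral (m1 := nu) lebesgue_measure (D := setT) (f := g)
  (fun B mB _ => lebesgue_measure_shift a mB)).
Qed.
End translation.

(** * Functions whose translates are continuous in L^2 *)

Section L2_translation.
Context {R : realType} {n : nat}.
Local Notation mu := (@lebesgue_rV R n).
Implicit Types f g : 'rV[R]_n -> R.

Lemma ge0_integral_rV_shift (a : 'rV[R]_n) (f : 'rV[R]_n -> \bar R) :
  measurable_fun setT f -> (forall x, 0 <= f x)%E ->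
  (\int[mu]_x f (x - a)%R = \int[mu]_x f x)%E.
Proof.
move=> mf f0.
have ms := measurable_rV_shift a.
pose nu : {measure set 'rV[R]_n -> \bar R} :=
  measure_function_pushforward__canonical__measure_function_Measure mu ms.
have f0' : {in setT, forall y, 0 <= f y}%E by move=> y _.
have := ge0_integral_pushforward ms mu measurableT mf f0'.
rewrite preimage_setT => <-.
exact: (eq_measure_integral (m1 := nu) mu (D := setT)
  (fun B mB _ => lebesgue_rV_shift a mB)).
Qed.

Definition translate (h : 'rV[R]_n) f : 'rV[R]_n -> R := fun x => f (x - h).

Lemma measurable_translate h f :
  measurable_fun setT f -> measurable_fun setT (translate h f).
Proof. by move=> mf; exact: (measurableT_comp mf (measurable_rV_shift h)). Qed.

(** Extended-real valued, so that its inequalities need measurability only and no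
integrability. *)
Definition sqdist f g : \bar R := (\int[mu]_x ((f x - g x) ^+ 2)%:E)%E.

Lemma measurable_sqdiff f g : measurable_fun setT f -> measurable_fun setT g ->
  measurable_fun setT (fun x => ((f x - g x) ^+ 2)%:E).
Proof.
by move=> mf mg; apply/measurable_EFinP/measurable_funX; exact: measurable_funB.
Qed.

Lemma measurable_sqr f : measurable_fun setT f ->
  measurable_fun setT (fun x => (f x ^+ 2)%:E).
Proof. by move=> mf; apply/measurable_EFinP; exact: measurable_funX. Qed.

Lemma integrable_sqr f : measurable_fun setT f ->
  (\int[mu]_x (f x ^+ 2)%:E < +oo)%E ->
  mu.-integrable setT (EFin \o (fun x => f x ^+ 2)).
Proof.
move=> mf foo; apply/integrableP; split; first exact: measurable_sqr.
by under eq_integral do rewrite gee0_abs ?lee_fin ?sqr_ge0//.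
Qed.

Lemma translate_sqr_lty h f : measurable_fun setT f ->
  (\int[mu]_x (f x ^+ 2)%:E < +oo)%E ->
  (\int[mu]_x (translate h f x ^+ 2)%:E < +oo)%E.
Proof.
move=> mf foo.
rewrite /translate (ge0_integral_rV_shift h (f := fun x => (f x ^+ 2)%:E))//.
  exact: measurable_sqr.
by move=> x; rewrite lee_fin sqr_ge0.
Qed.

Lemma sqdist_ge0 f g : (0 <= sqdist f g)%E.
Proof. by apply: integral_ge0 => x _; rewrite lee_fin sqr_ge0. Qed.

Lemma sqdist_translate h f g :
  measurable_fun setT f -> measurable_fun setT g ->
  sqdist (translate h f) (translate h g) = sqdist f g.
Proof.
move=> mf mg.
apply: (ge0_integral_rV_shift h (f := fun x => ((f x - g x) ^+ 2)%:E)).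
  exact: measurable_sqdiff.
by move=> x; rewrite lee_fin sqr_ge0.
Qed.

(** Serves to turn pointwise quadratic inequalities, such as
(p + q)^2 <= 2 p^2 + 2 q^2, into inequalities between squared distances. *)
Lemma sqdist_le2 (a b : R) f g f1 g1 f2 g2 : 0 <= a -> 0 <= b ->
  measurable_fun setT f -> measurable_fun setT g ->
  measurable_fun setT f1 -> measurable_fun setT g1 ->
  measurable_fun setT f2 -> measurable_fun setT g2 ->
  (forall x, (f x - g x) ^+ 2 <=
     a * (f1 x - g1 x) ^+ 2 + b * (f2 x - g2 x) ^+ 2) ->
  (sqdist f g <= a%:E * sqdist f1 g1 + b%:E * sqdist f2 g2)%E.
Proof.
move=> a0 b0 mf mg mf1 mg1 mf2 mg2 le.
have m1 := measurable_sqdiff mf1 mg1; have m2 := measurable_sqdiff mf2 mg2.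
have sq0 (u v : 'rV[R]_n -> R) x : (0 <= ((u x - v x) ^+ 2)%:E)%E.
  by rewrite lee_fin sqr_ge0.
rewrite /sqdist -!ge0_integralZl_EFin//.
rewrite -ge0_integralD//; first last.
- exact: measurable_funeM.
- by move=> x _; rewrite mule_ge0// lee_fin.
- exact: measurable_funeM.
- by move=> x _; rewrite mule_ge0// lee_fin.
apply: ge0_le_integral => //.
- exact: measurable_sqdiff.
- by apply: emeasurable_funD; exact: measurable_funeM.
- by move=> x _; rewrite -!EFinM -EFinD lee_fin.
Qed.

Definition L2_translation_continuous f := forall eps : R, 0 < eps ->
  \forall h \near (0 : 'rV[R]_n), (sqdist (translate h f) f < eps%:E)%E.

(** If g is close to f, then so are their translates by the same vector, by
translation invariance; the distance from f to its translate is therefore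
controlled by that for g. *)
Lemma L2_translation_continuous_lim f : measurable_fun setT f ->
  (forall eps : R, 0 < eps -> exists g, [/\ measurable_fun setT g,
     L2_translation_continuous g & (sqdist g f < eps%:E)%E]) ->
  L2_translation_continuous f.
Proof.
move=> mf approx e e0.
(* two uses of the quadratic triangle inequality cost 6 times the distance
   from g to f and 4 times the distance from g to its translate *)
have e160 : 0 < e / 16 by rewrite divr_gt0.
have [g [mg cg gf]] := approx _ e160.
have := cg _ e160; apply: filterS => h cgh.
have mfh := measurable_translate h mf; have mgh := measurable_translate h mg.
have tri u v w : measurable_fun setT u -> measurable_fun setT v ->
    measurable_fun setT w ->
    (sqdist u w <= 2%:E * sqdist u v + 2%:E * sqdist v w)%E.
  move=> mu_ mv mw; apply: sqdist_le2 => // x.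
  rewrite -subr_ge0.
  rewrite (_ : _ - _ = (u x - 2 * v x + w x) ^+ 2); last by ring.
  exact: sqr_ge0.
have sym u v : sqdist u v = sqdist v u.
  by apply: eq_integral => x _; rewrite -sqrrN opprB.
have fg : (sqdist (translate h f) (translate h g) < (e / 16)%:E)%E.
  by rewrite sqdist_translate// sym.
apply: (le_lt_trans (tri _ _ _ mfh mgh mf)).
have := tri _ _ _ mgh mg mf.
move: (sqdist_ge0 g f) (sqdist_ge0 (translate h g) g)
  (sqdist_ge0 (translate h f) (translate h g)) (sqdist_ge0 (translate h g) f).
move: gf cgh fg.
case: (sqdist g f) => [x1| |]//; case: (sqdist _ g) => [x2| |]//;
case: (sqdist _ (translate h g)) => [x3| |]//; case: (sqdist _ f) => [x4| |]//.
rewrite -!EFinM -!EFinD !lee_fin !lte_fin; lra.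
Qed.

Lemma L2_translation_continuous_lin (a : R) f g :
  measurable_fun setT f -> measurable_fun setT g ->
  L2_translation_continuous f -> L2_translation_continuous g ->
  L2_translation_continuous (fun x => a * f x + g x).
Proof.
move=> mf mg cf cg e e0.
(* 2 a^2 would suffice as a bound; the added 1 keeps b positive when a = 0 *)
pose b := 2 * (a ^+ 2 + 1).
have b0 : 0 < b by rewrite mulr_gt0// ltr_wpDl// sqr_ge0.
have e40 : 0 < e / 4 by rewrite divr_gt0.
have eb0 : 0 < e / (2 * b) by rewrite divr_gt0// mulr_gt0.
near=> h.
have cfh : (sqdist (translate h f) f < (e / (2 * b))%:E)%E.
  by near: h; exact: cf.
have cgh : (sqdist (translate h g) g < (e / 4)%:E)%E.
  by near: h; exact: cg.
have mfg : measurable_fun setT (fun x => a * f x + g x).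
  by apply: measurable_funD => //; exact: measurable_funM.
have := @sqdist_le2 b 2 _ _ _ _ _ _ (ltW b0) (ler0n _ 2)
  (measurable_translate h mfg) mfg (measurable_translate h mf) mf
  (measurable_translate h mg) mg.
move=> /(_ _)/le_lt_trans; apply.
  move=> x; rewrite /translate /b.
  set p := f x; set q := f (x - h); set r := g x; set s := g (x - h).
  rewrite -subr_ge0.
  rewrite (_ : _ - _ = (a * (q - p) - (s - r)) ^+ 2 + 2 * (q - p) ^+ 2);
    last by ring.
  by apply: addr_ge0; [exact: sqr_ge0|rewrite mulr_ge0// sqr_ge0].
have -> : e%:E = (b%:E * (e / (2 * b))%:E + 2%:E * (e / 4)%:E)%E.
  by rewrite -!EFinM -EFinD; congr EFin; field; rewrite gt_eqF.
by apply: lteD; rewrite lte_pmul2l// lte_fin.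
Unshelve. all: by end_near. Qed.

(** Dominated convergence makes the squared distance from f_ k to f tend to 0,
the domination being by (2 g)^2. *)
Lemma L2_translation_continuous_cvg (f_ : ('rV[R]_n -> R)^nat) f g :
  measurable_fun setT g -> (\int[mu]_x (g x ^+ 2)%:E < +oo)%E ->
  (forall k, measurable_fun setT (f_ k)) -> measurable_fun setT f ->
  (forall k x, `|f_ k x| <= g x) ->
  (forall x, f_ k x @[k --> \oo] --> f x) ->
  (forall k, L2_translation_continuous (f_ k)) ->
  L2_translation_continuous f.
Proof.
move=> mg ig mf_ mf lefg cvgf cf_; apply: L2_translation_continuous_lim => // e e0.
have lefg' x : `|f x| <= g x.
  have cn : `|f_ k x| @[k --> \oo] --> `|f x| by apply: cvg_norm; exact: cvgf.
  rewrite -(cvg_lim _ cn)//; apply: limr_le.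
    by apply/cvg_ex; eexists; exact: cn.
  by near=> k; exact: lefg.
have ig4 : mu.-integrable setT (fun x => (4%:E * (g x ^+ 2)%:E)%E).
  exact: integrableZl (integrable_sqr mg ig).
have cv x : setT x -> ((f_ k x - f x) ^+ 2)%:E @[k --> \oo] --> 0%E.
  move=> _; apply: cvg_EFin; first by near=> k.
  have c0 : f_ k x - f x @[k --> \oo] --> (0 : R).
    by rewrite -(subrr (f x)); apply: cvgB; [exact: cvgf|exact: cvg_cst].
  have := cvgM c0 c0; rewrite mulr0; exact.
have dom k x : setT x -> (`|((f_ k x - f x) ^+ 2)%:E| <= 4%:E * (g x ^+ 2)%:E)%E.
  move=> _; rewrite -EFinM /= lee_fin ger0_norm ?sqr_ge0//.
  have := lefg k x; have := lefg' x; rewrite !ler_norml => /andP[? ?] /andP[? ?].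
  have -> : 4 * g x ^+ 2 = (2 * g x) ^+ 2 :> R by ring.
  rewrite -(real_normK (num_real (f_ k x - f x))).
  by rewrite ler_sqr ?nnegrE ?ler_norml; [lra| |lra].
have := @dominated_cvg _ _ _ mu setT measurableT
  (fun k x => ((f_ k x - f x) ^+ 2)%:E) (cst 0%E) _
  (fun k => measurable_sqdiff (mf_ k) mf) cv _ ig4 dom.
rewrite integral0 => /(_ (fun _ _ => erefl))/fine_cvgP[fin /cvgr_lt lt0].
have lt_ := lt0 e e0.
have [k [fk lk]] : exists k, sqdist (f_ k) f \is a fin_num /\
   fine (sqdist (f_ k) f) < e.
  have : \forall k \near \oo, sqdist (f_ k) f \is a fin_num /\
   fine (sqdist (f_ k) f) < e.
    near=> k; split; near: k; [exact: fin|exact: lt_].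
  by move=> [k _ /(_ k (leqnn _))] ?; exists k.
by exists (f_ k); split => //; rewrite -(fineK fk) lte_fin.
Unshelve. all: by end_near. Qed.

End L2_translation.

(** * Lipschitz functions with bounded support *)

Section lipschitz_cutoff.
Context {R : realType} {n : nat}.
Local Notation mu := (@lebesgue_rV R n).
Implicit Types f g : 'rV[R]_n -> R.

Definition clamp (r : R) : R := Num.max 0 (Num.min 1 r).

Lemma clamp_ge0 r : 0 <= clamp r. Proof. by rewrite le_max lexx. Qed.

Lemma clamp_le1 r : clamp r <= 1.
Proof. by rewrite ge_max ler01 ge_min lexx. Qed.

Lemma clamp_eq1 r : 1 <= r -> clamp r = 1.
Proof. by move=> r1; rewrite /clamp (min_idPl r1); exact/max_idPr. Qed.

Lemma clamp_eq0 r : r <= 0 -> clamp r = 0.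
Proof. by move=> r0; apply/max_idPl; rewrite ge_min r0 orbT. Qed.

Lemma clamp_lipschitz r s : `|clamp r - clamp s| <= `|r - s|.
Proof.
have := ler_norm (r - s); have := ler_norm (s - r); have := normr_ge0 (s - r).
rewrite distrC; set d := `|r - s| => d0 rs sr.
rewrite ler_norml /clamp !maxEle !minEle.
by do 4?case: ifPn; rewrite -?ltNge => *; apply/andP; split; lra.
Qed.

Lemma measurable_clamp d (T : measurableType d) (h : T -> R) :
  measurable_fun setT h -> measurable_fun setT (fun x => clamp (h x)).
Proof. by move=> mh; apply: measurable_maxr => //; exact: measurable_minr. Qed.

(** Bounding the values by 0 and 1 makes this class closed under products. *)
Definition lipschitz01 f := [/\ measurable_fun setT f,
  forall x, 0 <= f x <= 1 &
  exists L : R, forall x y, `|f x - f y| <= L * `|x - y|].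

Lemma lipschitz01M f g :
  lipschitz01 f -> lipschitz01 g -> lipschitz01 (f \* g).
Proof.
move=> [mf f01 [L fL]] [mg g01 [K gK]]; split.
- exact: measurable_funM.
- move=> x; have /andP[? ?] := f01 x; have /andP[? ?] := g01 x.
  by rewrite /= mulr_ge0//= mulr_ile1.
- exists (L + K) => x y /=.
  have -> : f x * g x - f y * g y = f x * (g x - g y) + (f x - f y) * g y.
    by ring.
  rewrite (le_trans (ler_normD _ _))// !normrM mulrDl addrC lerD//.
    rewrite -[leRHS]mulr1 ler_pM// ger0_norm; by have /andP[] := g01 y.
  rewrite -[leRHS]mul1r ler_pM// ger0_norm; by have /andP[] := f01 x.
Qed.

Lemma measurable_rV_norm : measurable_fun setT (fun x : 'rV[R]_n => `|x|).
Proof.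
rewrite (_ : (fun _ => _) = (fun x : 'rV[R]_n =>
  \big[Num.max/0]_(ij <- index_enum ('I_1 * 'I_n)%type) `|x ij.1 ij.2|)).
  elim: (index_enum _) => [|[i j] s IH].
    by under eq_fun do rewrite big_nil; exact: measurable_cst.
  under eq_fun do rewrite big_cons.
  apply: measurable_maxr => //=.
  by apply: measurableT_comp => //; rewrite ord1; exact: measurable_coord.
by apply/funext => x; rewrite /Num.norm/= mx_normrE.
Qed.

Definition cutoff (M : R) (x : 'rV[R]_n) : R := clamp (M + 1 - `|x|).

Lemma cutoff_lipschitz01 M : lipschitz01 (cutoff M).
Proof.
split.
- apply: measurable_clamp; apply: measurable_funB => //.
  exact: measurable_rV_norm.
- by move=> x; rewrite clamp_ge0 clamp_le1.
- exists 1 => x y; rewrite mul1r (le_trans (clamp_lipschitz _ _))//.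
  by rewrite opprB addrC addrA subrK distrC ler_dist_dist.
Qed.

Lemma ball_measurable (M : R) : measurable [set x : 'rV[R]_n | `|x| <= M].
Proof.
rewrite (_ : mkset _ = (fun x : 'rV[R]_n => `|x|) @^-1` `]-oo, M]%classic).
  by rewrite -[X in measurable X]setTI; exact: measurable_rV_norm.
by apply/seteqP; split => x /=; rewrite in_itv.
Qed.

(** When |h| <= 1 the difference between f and its translate is at most L |h| and
vanishes outside the ball of radius M + 1. *)
Lemma L2_translation_continuous_lipschitz f M : lipschitz01 f ->
  (mu [set x | `|x|%R <= M + 1]%R < +oo)%E ->
  (forall x, M < `|x| -> f x = 0) -> L2_translation_continuous f.
Proof.
move=> [mf _ [L fL]] boo f0 e e0.
set B := [set x | _] in boo.
have mB : measurable B by exact: ball_measurable.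
pose c := fine (mu B).
have muB : mu B = c%:E by rewrite fineK// ge0_fin_numE.
have c0 : 0 <= c by rewrite fine_ge0.
pose D := L ^+ 2 * c + 1.
have D0 : 0 < D by rewrite ltr_wpDl// mulr_ge0// sqr_ge0.
have near1 : \forall h \near (0 : 'rV[R]_n), `|h| <= 1 by exact: nbhs0_le.
have nearD : \forall h \near (0 : 'rV[R]_n), `|h| < e / D.
  by exact/pseudometric_normed_Zmodule.nbhs0_lt/divr_gt0.
near=> h.
have h1 : `|h| <= 1 by near: h.
have hD : `|h| < e / D by near: h.
have le1 x : (((translate h f x - f x) ^+ 2)%:E <=
    ((L * `|h|) ^+ 2 * \1_B x)%:E)%E.
  rewrite lee_fin indicE; have [xB|xB] := boolP (x \in B).
    have le : `|translate h f x - f x| <= L * `|h|.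
      by rewrite (le_trans (fL _ _))// addrAC subrr sub0r normrN.
    rewrite mulr1 -(real_normK (num_real (_ - _))) ler_sqr ?nnegrE//.
    exact: le_trans (normr_ge0 _) le.
  have xM : M + 1 < `|x| by rewrite ltNge; apply: contra xB; rewrite inE.
  rewrite /translate !f0; first by rewrite subrr expr0n mulr0.
    by rewrite (le_lt_trans _ xM)// lerDl.
  by have := ler_normD (x - h) h; rewrite subrK => xh; lra.
have := measurable_sqdiff (measurable_translate h mf) mf.
move=> mth; apply: (@le_lt_trans _ _ (((L * `|h|) ^+ 2)%:E * mu B)%E).
  have mI : measurable_fun setT (EFin \o (\1_B : 'rV[R]_n -> R)).
    by apply/measurable_EFinP.
  rewrite -[X in mu X]setIT -integral_indic// -ge0_integralZl_EFin ?sqr_ge0//.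
  apply: ge0_le_integral => //.
  - by move=> x _; rewrite lee_fin sqr_ge0.
  - exact: measurable_funeM.
rewrite muB -EFinM lte_fin; move: hD; rewrite ltr_pdivlMr// => hD.
apply: le_lt_trans hD; rewrite /D exprMn mulrDr mulr1 -mulrA.
have -> : L ^+ 2 * (`|h| ^+ 2 * c) = `|h| * (L ^+ 2 * c) * `|h| by ring.
rewrite (@le_trans _ _ (`|h| * (L ^+ 2 * c)))// ?lerDl//.
have Lc0 : 0 <= L ^+ 2 * c by rewrite mulr_ge0// sqr_ge0.
by rewrite ler_piMr// mulr_ge0.
Unshelve. all: by end_near. Qed.

End lipschitz_cutoff.

(** * Indicators of bounded measurable sets *)

Section density.
Context {R : realType}.

Lemma ler_rV_norm n (x : 'rV[R]_n) (M : R) :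
  `|x| <= M <-> 0 <= M /\ forall i, `|x ord0 i| <= M.
Proof.
rewrite /Num.norm/= mx_normrE; split.
  move=> /bigmax_leP[M0 xM]; split => // i; exact: (xM (ord0, i)).
move=> [M0 xM]; apply/bigmax_leP; split => // -[i j] _ /=.
by rewrite (ord1 i); exact: xM.
Qed.

(** In dimension n + 1 the ball of the sup norm is contained in the product of an
interval and a ball of dimension n. *)
Lemma lebesgue_rV_ball n (M : R) :
  (@lebesgue_rV R n [set x | `|x|%R <= M]%R < +oo)%E.
Proof.
elim: n => [|n IH].
  by rewrite /= diracE; case: (_ \in _); rewrite ltry.
rewrite /= /pushforward.
pose B : set (measurableTypeR R * 'rV[R]_n) :=
  `[- M, M]%classic `*` [set x | `|x| <= M].
apply: (@le_lt_trans _ _ ((@lebesgue_measure R \x @lebesgue_rV R n) B)%E).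
  apply: le_measure; rewrite ?inE.
  - rewrite -[X in measurable X]setTI; apply: measurable_cons_rV => //.
    exact: ball_measurable.
  - apply: measurableX => //; exact: ball_measurable.
  - move=> [x y] /ler_rV_norm[M0 xM]; split => /=.
      rewrite in_itv/= -ler_norml; have := xM ord0.
      by have /(congr1 fst)/= := cons_rVK (x, y) => ->.
    apply/ler_rV_norm; split => // i; have := xM (rshift 1 i).
    suff -> : cons_rV (x, y) ord0 (rshift 1 i) = y ord0 i by [].
    exact: (row_mxEr (n1 := 1)).
rewrite product_measure1E//; last exact: ball_measurable.
rewrite lte_mul_pinfty//. rewrite [X in X \is a fin_num]lebesgue_measure_itv/=.
by case: ifP => // _; rewrite -EFinD ltry.
Qed.

Section fixed_dimension.
Context {n : nat}.
Local Notation mu := (@lebesgue_rV R n).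

(** The pi-system to which the pi-lambda theorem is applied: finite intersections
correspond to products of approximating functions, and the half-spaces in it
generate the Borel sets. *)
Definition lipschitz_approx_set (A : set 'rV[R]_n) := measurable A /\
  exists2 f_ : ('rV[R]_n -> R)^nat, forall k, lipschitz01 (f_ k) &
    forall x, f_ k x @[k --> \oo] --> (\1_A x : R).

Lemma lipschitz_approx_setI : setI_closed lipschitz_approx_set.
Proof.
move=> A B [mA [f_ lf fA]] [mB [g_ lg gB]]; split; first exact: measurableI.
exists (fun k => f_ k \* g_ k) => [k|x]; first exact: lipschitz01M.
by rewrite indicI; exact: cvgM.
Qed.

(** The approximating functions have the slope k across the hyperplane
x i = a; at each point they are eventually constant in k. *)
Lemma halfspace_lipschitz_approx (i : 'I_n) (a : R) :
  lipschitz_approx_set [set x | a < x ord0 i].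
Proof.
have mc := @measurable_coord R n i.
split.
  have := mc measurableT _ (measurable_itv `]a, +oo[).
  by rewrite setTI preimage_itvoy.
exists (fun k x => clamp (k%:R * (x ord0 i - a))) => [k|x].
  split.
  - by apply: measurable_clamp; apply: measurable_funM => //; exact: measurable_funB.
  - by move=> x; rewrite clamp_ge0 clamp_le1.
  - exists k%:R => x y; apply: (le_trans (clamp_lipschitz _ _)).
    rewrite -mulrBr opprB addrA subrK normrM ger0_norm// ler_wpM2l//.
    have -> : x ord0 i - y ord0 i = (x - y) ord0 i by rewrite !mxE.
    by have [_] := (ler_rV_norm (x - y) `|x - y|).1 (lexx _).
rewrite indicE; have [ax|xa] := ltP a (x ord0 i).
  rewrite mem_set//; apply: cvg_near_cst.
  near=> k; apply: clamp_eq1.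
  by rewrite -ler_pdivrMr ?subr_gt0// div1r; near: k; exact: nbhs_infty_ger.
rewrite memNset/=; last by rewrite ltNge xa.
apply: cvg_near_cst; apply: nearW => k; apply: clamp_eq0.
by rewrite mulr_ge0_le0// subr_le0.
Unshelve. all: by end_near. Qed.

Lemma measurable_g_lipschitz_approx :
  @measurable _ 'rV[R]_n `<=` <<s lipschitz_approx_set >>.
Proof.
move=> A mA; rewrite -[A]setTI.
have : measurable_fun setT
    (id : g_sigma_algebraType lipschitz_approx_set -> 'rV[R]_n).
  apply: measurable_fun_rV => i.
  apply: (measurability _ (RGenOInfty.measurableE R)).
  move=> _ [_ [a ->] <-]; rewrite setTI; apply: sub_sigma_algebra.
  by rewrite preimage_itvoy; exact: halfspace_lipschitz_approx.
by move=> /(_ measurableT _ mA).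
Qed.

Lemma cutoff_sqr_integrable M : (\int[mu]_x ((cutoff M x : R) ^+ 2)%:E < +oo)%E.
Proof.
set B := [set x : 'rV[R]_n | `|x| <= M + 1].
have mB : measurable B by exact: ball_measurable.
apply: (@le_lt_trans _ _ (\int[mu]_x (\1_B x)%:E)%E).
  have [mc c01 _] := @cutoff_lipschitz01 R n M.
  apply: ge0_le_integral => //.
  - by move=> x _; rewrite lee_fin sqr_ge0.
  - exact: measurable_sqr.
  - by apply/measurable_EFinP.
  - move=> x _; rewrite lee_fin indicE; have /andP[c0 c1] := c01 x.
    have [xM|xM] := leP `|x| (M + 1); first by rewrite mem_set// expr_le1.
    rewrite memNset/=; last by apply/negP; rewrite -ltNge.
    by rewrite /cutoff clamp_eq0 ?expr0n// subr_le0 ltW.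
by rewrite integral_indic// setIT; exact: lebesgue_rV_ball.
Qed.

(** The measurable sets A for which the conclusion holds form a lambda-system: a
proper difference amounts to a difference of functions, an increasing union to
a dominated pointwise limit.  The cutoff provides the dominating function. *)
Lemma L2_translation_continuous_cutoff_indic M (A : set 'rV[R]_n) :
  measurable A -> L2_translation_continuous (fun x => cutoff M x * \1_A x).
Proof.
have [mc c01 _] := @cutoff_lipschitz01 R n M.
have mcut (B : set 'rV[R]_n) : measurable B ->
    measurable_fun setT (fun x => cutoff M x * \1_B x).
  by move=> mB; apply: measurable_funM.
pose H := [set B : set 'rV[R]_n | measurable B /\
  L2_translation_continuous (fun x => cutoff M x * \1_B x)].
have leC (B : set 'rV[R]_n) x : `|cutoff M x * \1_B x| <= cutoff M x.
  have /andP[? ?] := c01 x.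
  rewrite normrM ger0_norm// ler_piMr// indicE.
  by case: (_ \in _); rewrite ?normr1 ?normr0.
have Lip (f : 'rV[R]_n -> R) : lipschitz01 f ->
    L2_translation_continuous (fun x => cutoff M x * f x).
  move=> lf; apply: (@L2_translation_continuous_lipschitz _ _ _ (M + 1)).
  - by apply: lipschitz01M => //; exact: cutoff_lipschitz01.
  - exact: lebesgue_rV_ball.
  - by move=> x xM; rewrite /cutoff clamp_eq0 ?mul0r// subr_le0 ltW.
suff : <<s lipschitz_approx_set >> `<=` H.
  by move=> sub mA; have [] := sub _ (measurable_g_lipschitz_approx mA).
apply: lambda_system_subset => //; first exact: lipschitz_approx_setI.
- split => //.
  + split => //; rewrite indicT.
    by apply: Lip; split => //=; [move=> x; rewrite ler01 lexx
      |exists 0 => x y; rewrite subrr normr0 mul0r].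
  + move=> B C CB [mB cB] [mC cC]; split; first exact: measurableD.
    rewrite (_ : (fun x => _) = fun x =>
      (- 1) * (cutoff M x * \1_C x) + cutoff M x * \1_B x).
      by apply: L2_translation_continuous_lin => //; exact: mcut.
    apply/funext => x; rewrite mulN1r addrC -mulrBr !indicE in_setD.
    have [xC|xC] := boolP (x \in C); last by rewrite subr0 andbT.
    by rewrite (_ : x \in B) ?subrr ?andbF// inE; apply/CB/set_mem.
  + move=> F ndF HF; have mF : measurable (\bigcup_k F k).
      by apply: bigcup_measurable => k _; have [] := HF k.
    split => //.
    apply: (@L2_translation_continuous_cvg _ _
      (fun k x => cutoff M x * \1_(F k) x) _ (cutoff M)) => //.
    * exact: cutoff_sqr_integrable.
    * by move=> k; apply: mcut; have [] := HF k.
    * exact: mcut.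
    * move=> x; apply: cvgM; first exact: cvg_cst.
      have [Fx|nF] := pselect ((\bigcup_k F k) x).
        rewrite (indicE _ (\bigcup_k F k)) mem_set//; move: Fx => [k _ Fk].
        apply: cvg_near_cst; near=> j.
        rewrite indicE mem_set//; move: Fk; apply/subsetPset/ndF.
        by near: j; exact: nbhs_infty_ge.
      rewrite (indicE _ (\bigcup_k F k)) memNset//.
      apply: cvg_near_cst; apply: nearW => j.
      by rewrite indicE memNset// => Fj; apply: nF; exists j.
    * by move=> k; have [] := HF k.
- move=> B [mB [f_ lf fB]]; split => //.
  apply: (@L2_translation_continuous_cvg _ _
    (fun k x => cutoff M x * f_ k x) _ (cutoff M)) => //.
  + exact: cutoff_sqr_integrable.
  + by move=> k; apply: measurable_funM => //; have [] := lf k.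
  + exact: mcut.
  + move=> k x; have /andP[? ?] := c01 x; have [_ /(_ x)/andP[? ?] _] := lf k.
    by rewrite normrM !ger0_norm// ler_piMr.
  + by move=> x; apply: cvgM; [exact: cvg_cst|exact: fB].
  + by move=> k; exact: Lip.
Unshelve. all: by end_near. Qed.

End fixed_dimension.
End density.

(** * Square integrable functions and their correlations *)

Import HBNNSimple.

Section convolution.
Context {R : realType} {n : nat}.
Local Notation mu := (@lebesgue_rV R n).
Implicit Types f g : 'rV[R]_n -> R.

(** A simple function is a linear combination of indicators of its level sets. *)
Lemma L2_translation_continuous_cutoff_nnsfun M (f : {nnsfun 'rV[R]_n >-> R}) :
  L2_translation_continuous (fun x => cutoff M x * f x).
Proof.
have [mc _ _] := @cutoff_lipschitz01 R n M.
have mterm r : measurable_fun setT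
    (fun x => cutoff M x * \1_(f @^-1` [set r]) x).
  by apply: measurable_funM => //; exact: measurable_indic.
pose F (s : seq R) x :=
  \sum_(r <- s) r * (cutoff M x * \1_(f @^-1` [set r]) x).
have mF s : measurable_fun setT (F s).
  apply: measurable_sum => r; exact: measurable_funM.
have FE s : L2_translation_continuous (F s).
  elim: s => [|r s IH].
    (* the zero function, as a cutoff times the indicator of the empty set *)
    rewrite (_ : F [::] = fun x => cutoff 0 x * \1_set0 x).
      exact: L2_translation_continuous_cutoff_indic.
    by apply/funext => x; rewrite /F big_nil indic0 mulr0.
  rewrite (_ : F (r :: s) = fun x =>
     r * (cutoff M x * \1_(f @^-1` [set r]) x) + F s x).
    by apply: L2_translation_continuous_lin => //;
      exact: L2_translation_continuous_cutoff_indic.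
  by apply/funext => x; rewrite /F big_cons.
rewrite (_ : (fun x => _) = F (finmap.enum_fset (fset_set (range f)))).
  exact: FE.
apply/funext => x; rewrite /F fimfunE fsbig_finite//= mulr_sumr.
by apply: eq_bigr => r _; rewrite mulrCA.
Qed.

(** f is the limit of simple functions below f, here multiplied by cutoffs of
growing radius. *)
Lemma ge0_L2_translation_continuous f : measurable_fun setT f ->
  (forall x, 0 <= f x) -> (\int[mu]_x (f x ^+ 2)%:E < +oo)%E ->
  L2_translation_continuous f.
Proof.
move=> mf f0 foo.
have mEf : measurable_fun setT (EFin \o f) by exact/measurable_EFinP.
pose s_ := nnsfun_approx measurableT mEf.
have cs x : s_ k x @[k --> \oo] --> f x.
  have := @cvg_nnsfun_approx _ _ _ _ measurableT _ mEf
    (fun x _ => f0 x) x Logic.I.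
  by move=> /fine_cvgP[].
have les k x : 0 <= s_ k x <= f x.
  apply/andP; split => //; rewrite -(cvg_lim _ (cs x))//.
  apply: nondecreasing_cvgn_le; last by apply/cvg_ex; eexists; exact: cs.
  by move=> i j ij; exact/lefP/nd_nnsfun_approx.
apply: (@L2_translation_continuous_cvg _ _
  (fun k x => cutoff k%:R x * s_ k x) _ f) => //.
- move=> k; apply: measurable_funM => //.
  by have [] := @cutoff_lipschitz01 R n k%:R.
- move=> k x; have [_ /(_ x)/andP[? ?] _] := @cutoff_lipschitz01 R n k%:R.
  have /andP[? ?] := les k x.
  by rewrite normrM !ger0_norm// (le_trans _ (_ : s_ k x <= f x))// ler_piMl.
- move=> x; rewrite -[f x]mul1r; apply: cvgM => //.
  apply: cvg_near_cst; near=> k; apply: clamp_eq1.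
  by rewrite lerBrDr addrC lerD2r; near: k; exact: nbhs_infty_ger.
- by move=> k; exact: L2_translation_continuous_cutoff_nnsfun.
Unshelve. all: by end_near. Qed.

(** The positive and negative parts of f have squares bounded by that of f. *)
Lemma square_integrable_L2_translation_continuous f :
  measurable_fun setT f -> (\int[mu]_x (f x ^+ 2)%:E < +oo)%E ->
  L2_translation_continuous f.
Proof.
move=> mf foo.
have part g : measurable_fun setT g -> (forall x, 0 <= g x) ->
    (forall x, g x ^+ 2 <= f x ^+ 2) -> L2_translation_continuous g.
  move=> mg g0 gf; apply: ge0_L2_translation_continuous => //.
  apply: le_lt_trans foo; apply: ge0_le_integral => //.
  - by move=> x _; rewrite lee_fin sqr_ge0.
  - exact: measurable_sqr.
  - exact: measurable_sqr.
  - by move=> x _; rewrite lee_fin.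
have sqm (y : R) : Num.max y 0 ^+ 2 <= y ^+ 2 :> R.
  by rewrite /Num.max; case: ifPn => _//; rewrite expr0n/= sqr_ge0.
have ge0m (y : R) : 0 <= Num.max y 0 :> R by rewrite le_max lexx orbT.
have mp : measurable_fun setT (fun x => Num.max (f x) 0 : R).
  exact: measurable_maxr.
have mn : measurable_fun setT (fun x => Num.max (- f x) 0 : R).
  by apply: measurable_maxr => //; exact: measurableT_comp.
have fE : f = (fun x => (- 1) * Num.max (- f x) 0 + Num.max (f x) 0).
  apply/funext => x; rewrite mulN1r !maxEle oppr_le0.
  by case: (lerP 0 (f x)) => fx; case: ifPn; rewrite -?ltNge => ?; lra.
rewrite fE; apply: (L2_translation_continuous_lin (-1) mn mp).
  by apply: part => // x; rewrite -[leRHS]sqrrN.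
exact: part.
Qed.

Lemma square_integrable_mul (w k : 'rV[R]_n -> R) :
  measurable_fun setT w -> measurable_fun setT k ->
  (\int[mu]_x (w x ^+ 2)%:E < +oo)%E -> (\int[mu]_x (k x ^+ 2)%:E < +oo)%E ->
  mu.-integrable setT (EFin \o (w \* k)).
Proof.
move=> mw mk woo koo.
have mwk : measurable_fun setT (EFin \o (w \* k)).
  by apply/measurable_EFinP; exact: measurable_funM.
apply/integrableP; split => //.
apply: (@le_lt_trans _ _ (\int[mu]_x ((w x ^+ 2)%:E + (k x ^+ 2)%:E))%E).
  apply: ge0_le_integral => //.
  - exact: measurableT_comp.
  - by apply: emeasurable_funD; exact: measurable_sqr.
  - move=> x _; rewrite -EFinD lee_fin normrM.
    rewrite -(real_normK (num_real (w x))) -(real_normK (num_real (k x))).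
    by rewrite -subr_ge0; nra.
rewrite ge0_integralD//; first exact: lte_add_pinfty.
all: by [exact: measurable_sqr|move=> x _; rewrite lee_fin sqr_ge0].
Qed.

Definition correlation (w k : 'rV[R]_n -> R) (x : 'rV[R]_n) : R :=
  \int[mu]_y (w y * k (y - x)).

(** The difference of the values at x and x0 is the integral of w times the
difference d of two translates of k.  It is at most t |w|^2 + |d|^2 / t for
every t > 0, where the bars denote the L^2 norm: t is chosen to make the first term
small, and then x close enough to x0 to make the second one small. *)
Theorem continuous_correlation (w k : 'rV[R]_n -> R) :
  measurable_fun setT w -> measurable_fun setT k ->
  (\int[mu]_x (w x ^+ 2)%:E < +oo)%E -> (\int[mu]_x (k x ^+ 2)%:E < +oo)%E ->
  continuous (correlation w k).
Proof.
move=> mw mk woo koo x0.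
have mkx x := measurable_translate x mk.
have koox x := translate_sqr_lty x mk koo.
have iwk x := square_integrable_mul mw (mkx x) woo (koox x).
have w20 : (0 <= \int[mu]_x (w x ^+ 2)%:E)%E.
  by apply: integral_ge0 => x _; rewrite lee_fin sqr_ge0.
pose S := fine (\int[mu]_x (w x ^+ 2)%:E)%E.
have SE : (\int[mu]_x (w x ^+ 2)%:E)%E = S%:E by rewrite fineK// ge0_fin_numE.
have S0 : 0 <= S by rewrite fine_ge0.
apply/(@cvgrPdist_lt _ _ _ (nbhs x0)) => e e0.
pose t := e / (2 * (S + 1)).
have t0 : 0 < t by rewrite divr_gt0// mulr_gt0// ltr_wpDl.
have tS : t * S < e / 2.
  rewrite /t -(ltr_pM2r (x := S + 1)) ?ltr_wpDl//.
  rewrite (_ : e / (2 * (S + 1)) * S * (S + 1) = e / 2 * S); last first.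
    by field; rewrite gt_eqF// ltr_wpDl.
  by rewrite ltr_pM2l ?divr_gt0// ltrDl.
have te0 : 0 < t * (e / 2) by rewrite mulr_gt0// divr_gt0.
have := square_integrable_L2_translation_continuous mk koo te0.
rewrite (near_shift x0 0); apply: filterS => x /=; rewrite sub0r => sh.
have md := measurable_sqdiff (mkx x) (mkx x0).
have sE : sqdist (translate x k) (translate x0 k) = sqdist (translate (x - x0) k) k.
  rewrite -(sqdist_translate x0 (measurable_translate (x - x0) mk) mk).
  congr sqdist; apply/funext => y; rewrite /translate.
  by rewrite -addrA -opprD [x0 + _]addrC subrK.
pose s := fine (sqdist (translate x k) (translate x0 k)).
have ssE : sqdist (translate x k) (translate x0 k) = s%:E.
  rewrite fineK// ge0_fin_numE ?sqdist_ge0// sE; exact: lt_trans sh (ltry _).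
have st : s < t * (e / 2) by rewrite -lte_fin -ssE sE.
have iw := integrable_sqr mw woo.
have id : mu.-integrable setT
    (EFin \o (fun y => (translate x k y - translate x0 k y) ^+ 2)).
  apply/integrableP; split => //.
  under eq_integral do rewrite gee0_abs ?lee_fin ?sqr_ge0//.
  by rewrite -/(sqdist _ _) ssE ltry.
have itw : mu.-integrable setT (EFin \o (fun y => t * w y ^+ 2)).
  by have := integrableZl measurableT t iw.
have itd : mu.-integrable setT
    (EFin \o (fun y => t^-1 * (translate x k y - translate x0 k y) ^+ 2)).
  by have := integrableZl measurableT t^-1 id.
rewrite /correlation -RintegralB//; [|exact: iwk|exact: iwk].
apply: (le_lt_trans (le_normr_Rintegral _ _)) => //.
  by have := integrableB measurableT (iwk x0) (iwk x).
apply: (@le_lt_trans _ _ (\int[mu]_y (t * w y ^+ 2 +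
    t^-1 * (translate x k y - translate x0 k y) ^+ 2))).
  apply: le_Rintegral => //.
  - apply: integrable_norm; have := integrableB measurableT (iwk x0) (iwk x); exact.
  - by have := integrableD measurableT itw itd.
  - move=> y _; rewrite -mulrBr -[k (y - x0)]/(translate x0 k y)
      -[k (y - x)]/(translate x k y) normrM.
    rewrite -(real_normK (num_real (w y))).
    rewrite -(real_normK (num_real (_ - _))) distrC.
    set a := `|w y|; set c := `| _ - _ |; rewrite -subr_ge0.
    rewrite (_ : _ - _ = t * (a - c / (2 * t)) ^+ 2 + 3 / (4 * t) * c ^+ 2).
      apply: addr_ge0; apply: mulr_ge0; rewrite ?sqr_ge0 ?(ltW t0)//.
      by rewrite divr_ge0// mulr_ge0// ltW.
    by field; rewrite gt_eqF.
rewrite RintegralD//.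
have -> : \int[mu]_y (t * w y ^+ 2) = t * S.
  by rewrite RintegralZl//.
have -> : \int[mu]_y (t^-1 * (translate x k y - translate x0 k y) ^+ 2) = t^-1 * s.
  by rewrite RintegralZl//.
rewrite [e]splitr ltrD// mulrC ltr_pdivrMr//; by rewrite mulrC.
Qed.

End convolution.

(** * Points within the horizon of Omega *)

Section interaction_range.
Context {R : realType} {n : nat}.
Implicit Types (Omega : set 'rV[R]_n) (x y : 'rV[R]_n).

Lemma enorm_ge0 x : 0 <= enorm x. Proof. exact: sqrtr_ge0. Qed.

Lemma enormZ (c : R) x : enorm (c *: x) = `|c| * enorm x.
Proof.
rewrite /enorm (_ : \sum_i _ = c ^+ 2 * \sum_i x ord0 i ^+ 2).
  by rewrite sqrtrM ?sqr_ge0// sqrtr_sqr.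
by rewrite mulr_sumr; apply: eq_bigr => i _; rewrite mxE exprMn.
Qed.

(** The parameter t is the infimum of those for which the point is outside
Omega. *)
Lemma boundary_on_segment Omega x y : open Omega -> Omega x -> ~ Omega y ->
  exists2 t : R, 0 < t <= 1 & boundary Omega (x + t *: (y - x)).
Proof.
move=> oO Ox nOy.
pose p (t : R) := x + t *: (y - x).
have cp : continuous p.
  by move=> t; apply: cvgD; [exact: cvg_cst|apply: cvgZl; exact: cvg_id].
have oT : open (p @^-1` Omega) by apply: open_comp => // t _; exact: cp.
pose E := [set t | 0 <= t /\ ~ Omega (p t)].
have E1 : E 1 by split => //; rewrite /p scale1r addrC subrK.
have E0 : lbound E 0 by move=> t [].
have hiE : has_inf E by split; [exists 1|exists 0].
pose t := inf E.
have tle s : E s -> t <= s by apply: ge_inf; exists 0.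
have t0 : 0 <= t by apply: lb_le_inf; first by exists 1.
have tlt s : 0 <= s -> s < t -> Omega (p s).
  move=> s0 st; apply: contrapT => nO.
  by move: st; rewrite ltNge tle.
have nOt : ~ Omega (p t).
  move=> Ot; have /nbhs_ballP[e /= e0 be] : nbhs t (p @^-1` Omega).
    exact: open_nbhs_nbhs.
  have [s Es ste] := inf_adherent e0 hiE.
  apply: Es.2; apply: be; rewrite /ball/= distrC ger0_norm.
    by rewrite ltrBlDl.
  by rewrite subr_ge0 tle.
have tgt0 : 0 < t.
  rewrite lt_neqAle t0 andbT; apply/eqP => t0E.
  by apply: nOt; rewrite -t0E /p scale0r addr0.
exists t; first by rewrite tgt0/= tle.
split; last by move=> /interior_subset.
move=> B /cp/nbhs_ballP[e /= e0 be].
pose s := Num.max 0 (t - e / 2).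
have s0 : 0 <= s by rewrite le_max lexx.
have st : s < t by rewrite gt_max tgt0 ltrBlDr ltrDl divr_gt0.
exists (p s); split; first exact: tlt.
apply: be; rewrite /ball/= ger0_norm ?subr_ge0 1?ltW//.
rewrite ltrBlDr -ltrBlDl lt_max; apply/orP; right.
by rewrite ltrD2l ltrN2 ltr_pdivrMr// ltr_pMr// ltr1n.
Qed.

(** The boundary point on the segment differs from x, so that its distance to y
is strictly less than delta. *)
Lemma enorm_le_interaction Omega (delta : R) x y : open Omega -> 0 < delta ->
  Omega x -> enorm (y - x) <= delta ->
  (Omega `|` interaction_domain delta Omega) y.
Proof.
move=> oO d0 Ox yx.
have [Oy|nOy] := pselect (Omega y); [by left|right; split => //].
have [t /andP[t0 t1] bt] := boundary_on_segment oO Ox nOy.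
apply: (@le_lt_trans _ _ (enorm (y - (x + t *: (y - x))))).
  apply: ge_inf; last by exists (x + t *: (y - x)).
  by exists 0 => _ [a _ <-]; exact: enorm_ge0.
have -> : y - (x + t *: (y - x)) = (1 - t) *: (y - x).
  by rewrite scalerBl scale1r opprD addrA.
rewrite enormZ ger0_norm ?subr_ge0//.
rewrite (@le_lt_trans _ _ ((1 - t) * delta))// ?ler_wpM2l ?subr_ge0//.
by rewrite gtr_pMl// gtrBl.
Qed.

End interaction_range.

(** * Continuity of the nonlocal solution *)

Theorem theorem2p1 (R : realType) (n : nat) (Omega : set 'rV[R]_n.+1)
    (delta : R) (gamma : 'rV[R]_n.+1 -> 'rV[R]_n.+1 -> R) (gammat : R -> R)
    (b u : 'rV[R]_n.+1 -> R)
    (Omega_domain : is_domain Omega)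
    (Omega_bounded : bounded_set Omega)
    (Omega_convex : convex_set (Omega : set (convex_lmodType 'rV[R]_n.+1)))
    (Omega_lipschitz : lipschitz_boundary Omega)
    (delta_gt0 : 0 < delta)
    (gamma_ge0 : forall x y, 0 <= gamma x y)
    (gamma_sym : forall x y, gamma x y = gamma y x)
    (gamma_K1 : kernel_K1 delta Omega gamma)
    (gamma_K2 : kernel_K2 gamma gammat)
    (gammat_range : forall r, delta < r -> gammat r = 0)
    (gammat_L2 : L2_on setT (fun s : 'rV[R]_n.+1 => gammat (enorm s)))
    (b_L2 : L2_on Omega b)
    (b_continuous : continuous_rep Omega b)
    (u_solution : nonlocal_solution delta Omega gamma b u) :
  continuous_rep Omega u.
Proof.
have [oO _ _] := Omega_domain.
case: gamma_K2 => gammaE int_k.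
case: u_solution => u_L2 _ u_eq.
set D := Omega `|` interaction_domain delta Omega in u_L2.
pose w := u \_ D.
pose k (z : 'rV[R]_n.+1) := gammat (enorm z).
have mL2 f : f \in Lfun (@lebesgue_rV R n.+1) 2%:E ->
    measurable_fun setT f /\ (\int[@lebesgue_rV R n.+1]_x (f x ^+ 2)%:E < +oo)%E.
  move=> fL; split; first by move: fL; rewrite inE => /andP[/[!inE]].
  have /integrableP[_] := Lfun2_integrable_sqr fL.
  by under eq_integral do rewrite gee0_abs ?lee_fin ?sqr_ge0//.
have [mw woo] := mL2 _ u_L2.
have [mk koo] : measurable_fun setT k /\
    (\int[@lebesgue_rV R n.+1]_x (k x ^+ 2)%:E < +oo)%E.
  apply: mL2; suff <- : k \_ setT = k by exact: gammat_L2.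
  by apply/funext => z; rewrite patchE in_setT.
have k0 z : 0 <= k z by have [_] := gammaE 0 z; rewrite subr0.
have [g cg bg] := b_continuous.
exists (fun x => g x + correlation w k x).
  have cW := continuous_correlation mw mk woo koo.
  move=> x; apply: cvgD; first exact: cg.
  exact: (continuous_subspaceT cW).
have int_kx x : (\int[@lebesgue_rV R n.+1]_y (translate x k y)%:E = 1)%E.
  rewrite -int_k -(ge0_integral_rV_shift x (f := fun z => (k z)%:E))//.
  exact/measurable_EFinP.
have nonlocal_opE x : Omega x -> nonlocal_op gamma u x = correlation w k x - u x.
  move=> Ox.
  have mkx := measurable_translate x mk.
  have ikx : (@lebesgue_rV R n.+1).-integrable setT (EFin \o translate x k).
    apply/integrableP; split; first exact/measurable_EFinP.
    under eq_integral do rewrite gee0_abs ?lee_fin ?k0//.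
    by rewrite int_kx ltry.
  have iwk : (@lebesgue_rV R n.+1).-integrable setT (EFin \o (w \* translate x k)).
    by apply: square_integrable_mul => //; exact: translate_sqr_lty.
  (* beyond the horizon gamma vanishes, within it y lies in D and w y = u y *)
  transitivity (\int[@lebesgue_rV R n.+1]_y
      (w y * translate x k y - u x * translate x k y)).
    apply: eq_Rintegral => y _; rewrite -mulrBl.
    rewrite (gammaE x y).1 -/(k (y - x)) -/(translate x k y).
    have [yx|yx] := leP (enorm (y - x)) delta; last first.
      by rewrite /translate /k gammat_range// !mulr0.
    by rewrite /w patchE mem_set//; exact: (enorm_le_interaction oO delta_gt0 Ox).
  rewrite RintegralB//; last by have := integrableZl measurableT (u x) ikx.
  rewrite RintegralZl//; congr (_ - _).
  by rewrite /Rintegral int_kx mulr1.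
apply: filterS2 bg u_eq => x bx ux Ox.
by rewrite -bx// -ux// nonlocal_opE// opprB subrK.
Qed.
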